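(* Let $T\ge 1$, $L>0$, and let $f_1,\dots,f_T:\mathbb{R}^d\to\mathbb{R}$ be convex and $L$-smooth. Let $f=\frac1T\sum_{t=1}^T f_t$, assume $f$ has a minimizer $x_*\in\arg\min f$, and let $\sigma_*^2:=\frac1T\sum_{t=1}^T\|\nabla f_t(x_* )\|^2<\infty$. Let $\alpha,\beta>0$ satisfy $\frac1\alpha+\frac1\beta\le\frac12$, and let Incremental Gradient Descent be run for $K$ epochs from $x_0$ with a fixed step size $0<\eta\le\frac{1}{\sqrt\beta\,TL}$. Let $c\in(0,1]$ be a constant and let $\{w_k\}_{k=0}^{K-1}$ be the sequence with $w_0>0$ and $$w_k=\frac{(1+\alpha/\beta)(K-k)+1-c}{(1+\alpha/\beta)(K-k)}\,w_{k-1},\qquad 1\le k\le K-1.$$ Then $\hat x_K:=\sum_{k=1}^K\frac{w_{k-1}x_k}{\sum_{j=1}^K w_{j-1}}$ satisfies $$f(\hat x_K)-f(x_* )\le\frac{T^2\sigma_*^2\eta^2L}{c}+\frac{\|x_0-x_*\|^2}{2c\,\eta TK}.$$ In particular, for every $\epsilon>0$ there is a constant step size $\eta$ such that $f(\hat x_K)-f(x_* )\le\epsilon$ after $$TK=\mathcal{O}\Big(\frac{TL\|x_0-x_*\|^2}{c\,\epsilon}+\frac{TL^{1/2}\sigma_*\|x_0-x_*\|^2}{c^{3/2}\epsilon^{3/2}}\Big)$$ individual gradient evaluations.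
   Context: $\|\cdot\|$ is the Euclidean norm on $\mathbb{R}^d$. A differentiable $g$ is $L$-smooth if $\|\nabla g(x)-\nabla g(y)\|\le L\|x-y\|$ for all $x,y$. Incremental Gradient Descent (IGD): given $x_0\in\mathbb{R}^d$, number of epochs $K$, and step sizes $\eta_k>0$ (here $\eta_k=\eta$); for $k=1,\dots,K$ set $x_{k-1,1}=x_{k-1}$, then for $t=1,\dots,T$ set $x_{k-1,t+1}=x_{k-1,t}-\eta_k\nabla f_t(x_{k-1,t})$, and set $x_k=x_{k-1,T+1}$. Each epoch uses $T$ individual gradient evaluations. Convention for the complexity claim: $\mathcal O(X)$ hides a constant depending only on $\alpha,\beta$ (which are regarded as fixed constants); the claim is that there exist $K$ and $\eta$ (allowed to depend on $K$ and the problem parameters) with $f(\hat x_K)-f(x_* )\le\epsilon$ and $TK=\mathcal O(X)$, read in the regime $X\ge T$ (at least one epoch). *)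

(* Defs.v *)
From HB Require Import structures.
From mathcomp Require Import all_boot all_order all_algebra.
From mathcomp Require Import boolp classical_sets reals topology normedtype.
From mathcomp Require Import derive exp convex.

Set Implicit Arguments.
Unset Strict Implicit.
Unset Printing Implicit Defensive.

Import Order.TTheory GRing.Theory Num.Theory.
Import numFieldNormedType.Exports.

Local Open Scope classical_set_scope.
Local Open Scope ring_scope.

Section Euclidean.
Context {R : realType} {d : nat}.

(* The library norm `|x| on 'rV[R]_d is the max norm, hence this definition. *)
Definition enorm (x : 'rV[R]_d) : R := Num.sqrt (\sum_(i < d) x 0 i ^+ 2).

Definition grad (g : 'rV[R]_d -> R) (x : 'rV[R]_d) : 'rV[R]_d :=
  \row_(i < d) 'D_(delta_mx 0 i) g x.

(* Differentiability is Frechet differentiability; that it is taken with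
   respect to the max norm is harmless since norms on R^d are equivalent. *)
Definition smooth (L : R) (g : 'rV[R]_d -> R) : Prop :=
  (forall x, differentiable g x) /\
  (forall x y, enorm (grad g x - grad g y) <= L * enorm (x - y)).

Definition convex_fun (g : 'rV[R]_d -> R) : Prop :=
  convex_function [set: convex_lmodType 'rV[R]_d] g.

End Euclidean.

Section IGD.
Context {R : realType} {d T : nat}.
Implicit Types (f : 'I_T -> 'rV[R]_d -> R) (x : 'rV[R]_d).

Definition average f x : R := (\sum_(t < T) f t x) / T%:R.

Definition sigma2 f x : R := (\sum_(t < T) enorm (grad (f t) x) ^+ 2) / T%:R.

Definition sigma f x : R := Num.sqrt (sigma2 f x).

(* enum 'I_T lists 0, ..., T - 1 in increasing order: component t of the text
   is f applied to the ordinal t - 1. *)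
Definition igd_epoch f (eta : R) x : 'rV[R]_d :=
  foldl (fun y t => y - eta *: grad (f t) y) x (enum 'I_T).

Fixpoint igd f (eta : nat -> R) x (k : nat) : 'rV[R]_d :=
  if k is k'.+1 then igd_epoch f (eta k) (igd f eta x k') else x.

End IGD.

Section Averaging.
Context {R : realType}.

Definition igd_weights (alpha beta c : R) (K : nat) (w : nat -> R) : Prop :=
  0 < w 0%N /\
  forall k, (1 <= k <= K.-1)%N ->
    w k = ((1 + alpha / beta) * (K - k)%:R + 1 - c) /
          ((1 + alpha / beta) * (K - k)%:R) * w k.-1.

Definition weighted_avg {d : nat} (w : nat -> R) (x : nat -> 'rV[R]_d)
    (K : nat) : 'rV[R]_d :=
  \sum_(1 <= k < K.+1) (w k.-1 / \sum_(1 <= j < K.+1) w j.-1) *: x k.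

End Averaging.

(* Main.v *)
(** During one epoch ending at x_k, smoothness and cocoercivity of each f_t,
    compared at an arbitrary point z, give with G = f - f(x_* )
      G(x_k) <= (1 + alpha/beta) G(z) + eta^2 T^2 sigma_*^2 L
                + (|x_{k-1} - z|^2 - |x_k - z|^2) / (2 eta T):
    the drift inside the epoch is split into the gradients at x_*, the
    difference between z and x_*, and the difference between the iterates and
    z, with Young weights 2, alpha and beta; the last part is absorbed by
    cocoercivity, the middle one by G(z).  Choosing for z the convex
    combinations z_k of x_* and of the previous iterates, with the ratios
    w_{k-1}/w_k, the distances telescope after weighting by w_{k-1}; the
    recursion for w leaves exactly c w_{k-1} G(x_k), and Jensen's inequality
    concludes. *)

Require Import Defs.
From mathcomp Require Import all_boot all_order all_algebra.
From mathcomp Require Import boolp classical_sets reals topology normedtype.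
From mathcomp Require Import derive exp convex interval_inference.
From mathcomp Require Import ring lra.
Import Order.TTheory GRing.Theory Num.Theory.
Import numFieldNormedType.Exports.
Local Open Scope classical_set_scope.
Local Open Scope ring_scope.

(** * Euclidean inner product and Young-type inequalities *)

Section InnerProduct.
Context {R : realType} {d : nat}.
Implicit Types (u v x y z : 'rV[R]_d) (a : R).

Definition dot u v : R := \sum_(i < d) u 0 i * v 0 i.

Lemma dotC u v : dot u v = dot v u.
Proof. by apply: eq_bigr => i _; rewrite mulrC. Qed.

Lemma dotDl u v x : dot (u + v) x = dot u x + dot v x.
Proof. by rewrite -big_split; apply: eq_bigr => i _; rewrite mxE mulrDl. Qed.

Lemma dotZl a u v : dot (a *: u) v = a * dot u v.
Proof. by rewrite mulr_sumr; apply: eq_bigr => i _; rewrite mxE mulrA. Qed.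

Lemma dotDr u v x : dot x (u + v) = dot x u + dot x v.
Proof. by rewrite !(dotC x) dotDl. Qed.

Lemma dotZr a u v : dot u (a *: v) = a * dot u v.
Proof. by rewrite !(dotC u) dotZl. Qed.

Lemma dotNl u v : dot (- u) v = - dot u v.
Proof. by rewrite -scaleN1r dotZl mulN1r. Qed.

Lemma dotNr u v : dot u (- v) = - dot u v.
Proof. by rewrite !(dotC u) dotNl. Qed.

Definition dotE := (dotDl, dotDr, dotZl, dotZr, dotNl, dotNr).

Lemma dot0l v : dot 0 v = 0.
Proof. by rewrite -(scale0r v) dotZl mul0r. Qed.

Lemma dot_suml (I : Type) (r : seq I) (P : pred I) (F : I -> 'rV[R]_d) v :
  dot (\sum_(i <- r | P i) F i) v = \sum_(i <- r | P i) dot (F i) v.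
Proof. by elim/big_rec2: _ => [|i s w _ <-]; rewrite ?dot0l ?dotDl. Qed.

Lemma dot_ge0 v : 0 <= dot v v.
Proof. by apply: sumr_ge0 => i _; rewrite -expr2 sqr_ge0. Qed.

Lemma enorm_sqr v : enorm v ^+ 2 = dot v v.
Proof.
rewrite sqr_sqrtr; last by apply: sumr_ge0 => i _; rewrite sqr_ge0.
by apply: eq_bigr => i _; rewrite expr2.
Qed.

Lemma dot_eq0 v : dot v v <= 0 -> v = 0.
Proof.
move=> v0; have {v0} : dot v v == 0 by rewrite eq_le v0 dot_ge0.
rewrite psumr_eq0; last by move=> i _; rewrite -expr2 sqr_ge0.
move=> /allP v0; apply/rowP => i; rewrite mxE.
by have := v0 i (mem_index_enum _); rewrite -expr2 sqrf_eq0 => /eqP.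
Qed.

Lemma dot_young (a : R) u v : 0 < a ->
  2 * dot u v <= a * dot u u + a^-1 * dot v v.
Proof.
move=> a0; have := dot_ge0 (a *: u - v); rewrite !dotE (dotC v u) => h.
rewrite -(ler_pM2l a0) [a * (_ + _)]mulrDr mulVKf ?gt_eqF//.
by nra.
Qed.

(** Apply Young's inequality to the total [s] against each summand, with the inverse weights. Adding
    up gives [(2 - (p^-1 + q^-1 + r^-1)) * dot s s] on the left, which is at least [dot s s]. *)
Lemma dot_young3 (p q r : R) u v x : 0 < p -> 0 < q -> 0 < r ->
  p^-1 + q^-1 + r^-1 <= 1 ->
  dot (u + v + x) (u + v + x) <= p * dot u u + q * dot v v + r * dot x x.
Proof.
move=> p0 q0 r0 pqr.
have split a b (y : 'rV[R]_d) : 0 < a ->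
    2 * dot b y - a^-1 * dot b b <= a * dot y y.
  move=> a0; have := dot_young a^-1 b y.
  by rewrite invr_gt0 invrK => /(_ a0); lra.
have := split p (u + v + x) u p0; have := split q (u + v + x) v q0.
have := split r (u + v + x) x r0.
set s := u + v + x.
have -> : dot s s = dot s u + dot s v + dot s x by rewrite -!dotDr.
have : 0 <= dot s u + dot s v + dot s x by rewrite -!dotDr dot_ge0.
set S := dot s u + dot s v + dot s x => S0 h1 h2 h3.
have : (p^-1 + q^-1 + r^-1) * S <= S by rewrite ler_piMl.
by rewrite {}/S in h1 h2 h3 S0 *; lra.
Qed.

(** A variance argument: for [H], the extension of [F] by zero outside [P], the sum of the squares
    of [n H_i - S] is nonnegative. Bounding partial sums by the full range makes the bound
    independent of [P]. *)
Lemma dot_sum_le (n : nat) (P : pred 'I_n) (F : 'I_n -> 'rV[R]_d) :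
  dot (\sum_(i | P i) F i) (\sum_(i | P i) F i)
    <= n%:R * \sum_i dot (F i) (F i).
Proof.
set S := \sum_(i | P i) F i.
have [n0|n0] := posnP n.
  rewrite /S big1 ?dot0l ?mulr_ge0 ?ler0n// => [|i].
    by apply: sumr_ge0 => i _; exact: dot_ge0.
  by have := ltn_ord i; rewrite [X in (_ < X)%N]n0.
have nR0 : 0 < n%:R :> R by rewrite ltr0n.
pose H i := if P i then F i else 0.
have SE : S = \sum_i H i by rewrite /S big_mkcond.
apply: (@le_trans _ _ (n%:R * \sum_i dot (H i) (H i))); last first.
  rewrite ler_pM2l//; apply: ler_sum => i _; rewrite /H.
  by case: ifP => // _; rewrite dot0l dot_ge0.
have : 0 <= \sum_i dot (n%:R *: H i - S) (n%:R *: H i - S).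
  by apply: sumr_ge0 => i _; exact: dot_ge0.
have -> : \sum_i dot (n%:R *: H i - S) (n%:R *: H i - S)
   = n%:R * (n%:R * \sum_i dot (H i) (H i) - dot S S).
  under eq_bigr => i _.
    rewrite (_ : dot _ _ = n%:R ^+ 2 * dot (H i) (H i)
      + (- (2 * n%:R)) * dot (H i) S + dot S S); last first.
      by rewrite !dotE (dotC S (H i)); ring.
    over.
  rewrite !big_split/= -!mulr_sumr -dot_suml -SE sumr_const card_ord.
  by rewrite -mulr_natl; ring.
by rewrite pmulr_rge0// subr_ge0.
Qed.

End InnerProduct.

(** * Quadratic bounds for smooth and convex functions *)

Section SmoothConvex.
Context {R : realType} {d : nat}.
Implicit Types (f : 'rV[R]_d -> R) (x y z v : 'rV[R]_d) (L : R).

Lemma derive_grad f x v : differentiable f x -> 'D_v f x = dot (grad f x) v.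
Proof.
move=> df; rewrite deriveE// {1}(row_sum_delta v) linear_sum.
apply: eq_bigr => i _; rewrite linearZ /= mxE deriveE// mulrC//.
Qed.

Lemma is_derive_line f y v (s : R) : differentiable f (y + s *: v) ->
  is_derive s 1 (fun s : R => f (y + s *: v)) (dot (grad f (y + s *: v)) v).
Proof.
move=> df; rewrite -derive_grad//.
have E (h : R) : f (y + (h *: 1 + s) *: v) = f (h *: v + (y + s *: v)).
  by rewrite scalerDl [h *: 1]mulr1 addrCA.
have DE : (fun h : R => h^-1 *: (f (y + (h *: 1 + s) *: v) - f (y + s *: v)))
  = (fun h : R => h^-1 *: (f (h *: v + (y + s *: v)) - f (y + s *: v))).
  by apply/funext => h; rewrite E.
split; last by rewrite /derive /= DE.
by rewrite /derivable /= DE; exact: diff_derivable.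
Qed.

Lemma smooth_dot {L f} : 0 < L -> smooth L f -> forall x y,
  dot (grad f x - grad f y) (grad f x - grad f y)
    <= L ^+ 2 * dot (x - y) (x - y).
Proof.
move=> L0 [_ sf] x y; rewrite -!enorm_sqr -exprMn.
by rewrite lerXn2r// nnegrE ?mulr_ge0 ?sqrtr_ge0// ltW.
Qed.

Lemma gradN f x : differentiable f x ->
  grad (fun x => - f x) x = - grad f x.
Proof.
by move=> df; apply/rowP => i; rewrite !mxE deriveN//; exact: diff_derivable.
Qed.

(** Turns the quadratic upper bound [smooth_upper] into a lower bound. *)
Lemma smoothN L f : smooth L f -> smooth L (fun x => - f x).
Proof.
move=> [df sf]; split=> [x|x y]; first exact: differentiableN.
rewrite !gradN// -opprD /enorm; under eq_bigr do rewrite mxE sqrrN.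
exact: sf.
Qed.

(** Mean value theorem on [0, 1] for [phi], the gap between [f] on the segment and its quadratic
    model. The slope of [phi] is never positive there. *)
Lemma smooth_upper {L f} : 0 < L -> smooth L f -> forall x y,
  f x <= f y + dot (grad f y) (x - y) + L / 2 * dot (x - y) (x - y).
Proof.
move=> L0 sf x y; set v := x - y.
pose a := dot (grad f y) v; pose b := L / 2 * dot v v.
pose phi (s : R) := f (y + s *: v) - (s * a + s ^+ 2 * b).
pose dphi (s : R) := dot (grad f (y + s *: v)) v - (a + 2 * s * b).
have dp (s : R) : is_derive s 1 phi (dphi s).
  apply: is_deriveB; first exact/is_derive_line/sf.1.
  by apply: is_derive_eq; rewrite /GRing.scale/=; ring.
have cphi : {within `[0, 1], continuous phi}.
  apply: continuous_subspaceT => s.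
  apply/differentiable_continuous/derivable1_diffP.
  exact: (@ex_derive _ _ _ _ _ _ _ (dp s)).
have [s] := MVT ltr01 (fun s _ => dp s) cphi.
rewrite in_itv/= => /andP[s0 s1].
rewrite /phi scale1r scale0r addr0 (_ : y + v = x); last by rewrite addrC subrK.
suff : dphi s <= 0 by rewrite /a /b; nra.
have := smooth_dot L0 sf (y + s *: v) y; rewrite addrAC subrr add0r.
set g := grad f _ - grad f y => gv.
(* This weight balances both Young terms at [L * s * dot v v], the value that Cauchy-Schwarz would
   give. *)
have := dot_young (L * s)^-1 g v; rewrite invr_gt0 mulr_gt0// invrK.
rewrite dotZl dotZr in gv.
move=> /(_ isT) h; have {gv} : (L * s)^-1 * dot g g <= L * s * dot v v.
  rewrite ler_pdivrMl ?mulr_gt0//; apply: le_trans gv _.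
  by rewrite [leLHS](_ : _ = L * s * (L * s * dot v v)) //; ring.
move: h; have -> : dot g v = dphi s + L * s * dot v v.
  by rewrite /dphi /g dotDl dotNl /a /b; field.
by lra.
Qed.

Lemma convex_funE {f} : convex_fun f -> forall (s : R) x y, 0 <= s <= 1 ->
  f (s *: x + (1 - s) *: y) <= s * f x + (1 - s) * f y.
Proof.
move=> cf s x y /andP[s0 s1].
have := cf (Itv01 s0 s1) x y; rewrite !inE => /(_ Logic.I Logic.I).
by [].
Qed.

(** Convexity bounds [f (y + s v)] from above and smoothness of [- f] bounds it from below. After
    division by [s] the error is [s * b], so a small explicit [s] replaces a limit. *)
Lemma convex_first_order {L f} : 0 < L -> smooth L f -> convex_fun f ->
  forall x y, f y + dot (grad f y) (x - y) <= f x.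
Proof.
move=> L0 sf cf x y; set v := x - y.
pose b := L / 2 * dot v v.
have b0 : 0 <= b by rewrite mulr_ge0 ?dot_ge0 ?divr_ge0 ?ltW.
apply/ler_addgt0Pr => e e0.
(* Chosen to have both [s <= 1] and [s * b <= e], even when [b = 0]. *)
pose s := e / (b + e); have be0 : 0 < b + e by rewrite ltr_wpDl.
have s0 : 0 < s by rewrite divr_gt0.
have s1 : s <= 1 by rewrite ler_pdivrMr// mul1r lerDr.
have sb : s * b <= e by rewrite mulrAC ler_pdivrMr//; nra.
have := smooth_upper L0 (smoothN _ _ sf) (y + s *: v) y.
have -> : y + s *: v - y = s *: v by rewrite addrAC subrr add0r.
rewrite (gradN _ _ (sf.1 y)) dotNl dotZl !dotZr => h1.
have := convex_funE cf s x y; rewrite (ltW s0) s1 => /(_ isT).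
rewrite (_ : s *: x + _ = y + s *: v); last first.
  by rewrite /v scalerBr scalerBl scale1r addrC addrA addrAC.
move=> h2; rewrite -(ler_pM2l s0).
have : s * (s * b) <= s * e by rewrite ler_pM2l.
by rewrite /b; lra.
Qed.

(** Compare two bounds at the trial point [u = x - g / L]: the tangent at [y] lies below [f u], and
    the quadratic model at [x] lies above it. *)
Lemma smooth_convex_lower {L f} : 0 < L -> smooth L f -> convex_fun f ->
  forall x y, f y + dot (grad f y) (x - y)
    + (2 * L)^-1 * dot (grad f x - grad f y) (grad f x - grad f y) <= f x.
Proof.
move=> L0 sf cf x y; set g := grad f x - grad f y.
pose u := x - L^-1 *: g.
have := convex_first_order L0 sf cf u y.
have := smooth_upper L0 sf u x.
have -> : u - x = - (L^-1 *: g) by rewrite /u addrAC subrr add0r.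
have -> : u - y = x - y - L^-1 *: g by rewrite /u addrAC.
have : dot g g = dot (grad f x) g - dot (grad f y) g.
  by rewrite {1}/g dotDl dotNl.
clearbody u; clearbody g; move=> gg; rewrite !dotE invfM gg.
set A := dot (grad f x) g; set B := dot (grad f y) g.
have -> : L / 2 * - (L^-1 * - (L^-1 * (A - B))) = 2^-1 * L^-1 * (A - B).
  by field; rewrite gt_eqF.
by lra.
Qed.

End SmoothConvex.

(** * Progress of one epoch against an arbitrary comparison point *)

Section Epoch.
Context {R : realType} {d T : nat} {f : 'I_T -> 'rV[R]_d -> R}.
Implicit Types (x y z : 'rV[R]_d) (eta L alpha beta : R).

Lemma igd_epoch_path eta x : exists y : nat -> 'rV[R]_d,
  [/\ y 0%N = x, y T = igd_epoch f eta x &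
      forall t : 'I_T, y t.+1 = y t - eta *: grad (f t) (y t)].
Proof.
exists (fun k => foldl (fun y t => y - eta *: grad (f t) y) x
                       (take k (enum 'I_T))); split => [|| t].
- by rewrite take0.
- by rewrite take_oversize// size_enum_ord.
- rewrite (take_nth t) ?size_enum_ord//.
  by rewrite -cats1 foldl_cat nth_ord_enum.
Qed.

(** Drift is measured to the end of the epoch, since the bound concerns the function value at [y T].
    The case [t = 0] gives the step of the whole epoch. *)
Lemma igd_path_tail eta (y : nat -> 'rV[R]_d) :
  (forall t : 'I_T, y t.+1 = y t - eta *: grad (f t) (y t)) ->
  forall t : nat, (t <= T)%N ->
  y t - y T = eta *: \sum_(s < T | (t <= s)%N) grad (f s) (y s).
Proof.
move=> yS t tT; rewrite scaler_sumr -opprB -(telescope_sumr y tT) -sumrN.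
rewrite big_geq_mkord; apply: eq_bigr => s _.
by rewrite yS opprB opprB addrC subrK.
Qed.

(* Descent step from the minimizer with step size 1 / (T L). *)
Lemma sum_grad_minimizer L xs : (0 < T)%N -> 0 < L ->
  (forall t, smooth L (f t)) -> (forall x, average f xs <= average f x) ->
  \sum_t grad (f t) xs = 0.
Proof.
move=> T0 L0 sf min; have TR0 : 0 < T%:R :> R by rewrite ltr0n.
set g := \sum_t _; apply: dot_eq0.
pose s := (T%:R * L)^-1; have s0 : 0 < s by rewrite invr_gt0 mulr_gt0.
have := min (xs - s *: g); rewrite ler_pM2r ?invr_gt0// => fmin.
have : \sum_t f t (xs - s *: g) <= \sum_t (f t xs
    + dot (grad (f t) xs) (- (s *: g)) + L / 2 * (s * s * dot g g)).
  apply: ler_sum => t _; apply: le_trans (smooth_upper L0 (sf t) _ xs) _.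
  have -> : xs - s *: g - xs = - (s *: g) by rewrite addrAC subrr add0r.
  rewrite lerD2l.
  by rewrite dotNl dotNr opprK dotZl dotZr -[s * s * _]mulrA.
rewrite !big_split/= -dot_suml -/g dotNr dotZr sumr_const card_ord
  -[_ *+ T]mulr_natl.
(* With this [s] the quadratic term takes back only half of the linear decrease [s * dot g g]. *)
have -> : T%:R * (L / 2 * (s * s * dot g g)) = s / 2 * dot g g.
  by rewrite /s; field; rewrite !gt_eqF.
by move: g fmin => g; set F := \sum_i _ => fmin ub; nra.
Qed.

Lemma epoch_progress L alpha beta eta xs x z :
  0 < L -> 0 < alpha -> 0 < beta -> 0 < eta ->
  2^-1 + alpha^-1 + beta^-1 <= 1 ->
  beta * (eta * T%:R * L) ^+ 2 <= 1 ->
  (forall t, smooth L (f t)) -> (forall t, convex_fun (f t)) ->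
  \sum_t grad (f t) xs = 0 ->
  \sum_t (f t (igd_epoch f eta x) - f t z) <=
    alpha / beta * \sum_t (f t z - f t xs)
    + eta ^+ 2 * T%:R ^+ 2 * L * \sum_t dot (grad (f t) xs) (grad (f t) xs)
    + (2 * eta)^-1 * (dot (x - z) (x - z)
        - dot (igd_epoch f eta x - z) (igd_epoch f eta x - z)).
Proof.
move=> L0 al0 be0 e0 ab small sf cf gs0.
have [y [y0 yT yS]] := igd_epoch_path eta x; rewrite -yT.
pose g t := grad (f t) (y t); pose gz t := grad (f t) z.
pose gs t := grad (f t) xs.
pose A := \sum_t dot (gs t) (gs t).
pose B := \sum_t dot (gz t - gs t) (gz t - gs t).
pose C := \sum_t dot (gz t - g t) (gz t - g t).
(* A drift bound uniform in [t]: the factor [T] comes from [dot_sum_le], the weights from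
   [dot_young3]. *)
pose M := T%:R * (2 * A + alpha * B + beta * C).
have drift (t : 'I_T) : dot (y T - y t) (y T - y t) <= eta ^+ 2 * M.
  rewrite -opprB dotNl dotNr opprK.
  rewrite (igd_path_tail eta y yS t (ltnW (ltn_ord t))).
  rewrite dotZl dotZr mulrA -expr2 ler_pM2l ?exprn_gt0//.
  have -> : \sum_(s < T | (t <= s)%N) grad (f s) (y s)
      = \sum_(s < T | (t <= s)%N) gs s + \sum_(s < T | (t <= s)%N) (gz s - gs s)
        + \sum_(s < T | (t <= s)%N) (g s - gz s).
    rewrite -!big_split/=; apply: eq_bigr => s _.
    by rewrite [gs s + _]addrC subrK addrC subrK.
  apply: le_trans (dot_young3 2 alpha beta _ _ _ _ al0 be0 ab) _ => //.
  rewrite /M !mulrDr; apply: lerD; first apply: lerD.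
  - by rewrite mulrCA ler_pM2l//; exact: dot_sum_le.
  - by rewrite mulrCA ler_pM2l//; exact: dot_sum_le.
  - rewrite mulrCA ler_pM2l//; apply: le_trans (dot_sum_le _ _ _) _.
    rewrite ler_wpM2l ?ler0n//; apply: ler_sum => s _.
    by rewrite -opprB dotNl dotNr opprK.
(* Both bounds are expanded at [y t]: smoothness towards [y T], cocoercivity towards [z]. Their
   difference cancels [f t (y t)]. *)
have step (t : 'I_T) : f t (y T) - f t z <= dot (g t) (y T - z)
    + L / 2 * (eta ^+ 2 * M) - (2 * L)^-1 * dot (gz t - g t) (gz t - g t).
  have up := smooth_upper L0 (sf t) (y T) (y t).
  have lo := smooth_convex_lower L0 (sf t) (cf t) z (y t).
  have dr : L / 2 * dot (y T - y t) (y T - y t) <= L / 2 * (eta ^+ 2 * M).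
    by rewrite ler_pM2l ?divr_gt0.
  rewrite -/(g t) -/(gz t) in up lo.
  have -> : dot (g t) (y T - z) = dot (g t) (y T - y t) - dot (g t) (z - y t).
    by rewrite -dotNr -dotDr opprB addrA subrK.
  lra.
apply: (@le_trans _ _ (\sum_(t < T) (dot (g t) (y T - z)
    + L / 2 * (eta ^+ 2 * M) - (2 * L)^-1 * dot (gz t - g t) (gz t - g t)))).
  by apply: ler_sum => t _; exact: step.
have -> : \sum_(t < T) (dot (g t) (y T - z) + L / 2 * (eta ^+ 2 * M)
      - (2 * L)^-1 * dot (gz t - g t) (gz t - g t))
    = dot (\sum_t g t) (y T - z) + T%:R * (L / 2 * (eta ^+ 2 * M))
      - (2 * L)^-1 * C.
  rewrite !big_split/= sumrN -dot_suml sumr_const card_ord -[_ *+ T]mulr_natl.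
  by rewrite /C [in RHS]mulr_sumr.
(* Polarization, as the gradient sum is [(x - y T) / eta]. The negative square of [x - y T] is
   discarded at the end. *)
have -> : dot (\sum_t g t) (y T - z) =
    (2 * eta)^-1 * (dot (x - z) (x - z) - dot (y T - z) (y T - z)
                    - dot (x - y T) (x - y T)).
  have xyT : eta *: \sum_t g t = x - y T.
    by rewrite -y0 (igd_path_tail eta y yS 0).
  have -> : \sum_t g t = eta^-1 *: (x - y T).
    by rewrite -xyT scalerA mulVf ?scale1r ?gt_eqF.
  have -> : x - z = (x - y T) + (y T - z) by rewrite addrA subrK.
  move: (x - y T) (y T - z) => u v; rewrite !dotE (dotC v u).
  by field; rewrite gt_eqF.
(* The linear terms of cocoercivity at [xs] vanish in total because the gradients there sum to
   zero. *)
have B_le : (2 * L)^-1 * B <= \sum_t (f t z - f t xs).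
  have -> : \sum_t (f t z - f t xs)
      = \sum_t (f t z - f t xs - dot (gs t) (z - xs)).
    by rewrite [RHS]big_split/= sumrN -dot_suml gs0 dot0l subr0.
  rewrite mulr_sumr; apply: ler_sum => t _.
  have := smooth_convex_lower L0 (sf t) (cf t) z xs.
  by rewrite -/(gs t) -/(gz t); lra.
have A0 : 0 <= A by apply: sumr_ge0 => t _; exact: dot_ge0.
have B0 : 0 <= B by apply: sumr_ge0 => t _; exact: dot_ge0.
have C0 : 0 <= C by apply: sumr_ge0 => t _; exact: dot_ge0.
have xy0 : 0 <= (2 * eta)^-1 * dot (x - y T) (x - y T).
  by rewrite mulr_ge0 ?dot_ge0// invr_ge0 mulr_ge0// ltW.
(* The factor isolated here is at most 1 by the step size condition. The [C] part then cancels
   against the cocoercivity gain, and the [B] part is bounded by [B_le]. *)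
have TM : T%:R * (L / 2 * (eta ^+ 2 * M)) =
  eta ^+ 2 * T%:R ^+ 2 * L * A
  + (beta * (eta * T%:R * L) ^+ 2) * (alpha / beta * ((2 * L)^-1 * B)
                                     + (2 * L)^-1 * C).
  by rewrite /M; field; rewrite !gt_eqF.
rewrite TM; set q := (X in X * (_ + _)).
have r0 : 0 <= alpha / beta by rewrite divr_ge0 ?ltW.
have l0 : 0 <= (2 * L)^-1 by rewrite invr_ge0 mulr_ge0 ?ltW.
have : q * (alpha / beta * ((2 * L)^-1 * B) + (2 * L)^-1 * C)
    <= alpha / beta * ((2 * L)^-1 * B) + (2 * L)^-1 * C.
  by rewrite ler_piMl// addr_ge0// mulr_ge0// mulr_ge0.
have := ler_wpM2l r0 B_le; rewrite -/gs -/A; move: A {TM M drift step A0} => A.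
rewrite [(2 * eta)^-1 * (_ - _ - _)]mulrBr; lra.
Qed.

End Epoch.

(** * Jensen's inequality and the weighted telescoping argument *)

Section Averaging.
Context {R : realType} {d : nat}.
Implicit Types (x : nat -> 'rV[R]_d) (G : 'rV[R]_d -> R) (w : nat -> R).

Definition segment_convex G := forall (s : R) u v, 0 <= s <= 1 ->
  G (s *: u + (1 - s) *: v) <= s * G u + (1 - s) * G v.

(** Induction on [n]: the earlier points, merged into their own average with mass [s], form a
    two-point combination with the last one. *)
Lemma jensen_nat G w x n : segment_convex G ->
  (forall k, (k <= n)%N -> 0 < w k) ->
  G (\sum_(0 <= k < n.+1) (w k / \sum_(0 <= j < n.+1) w j) *: x k)
    <= (\sum_(0 <= k < n.+1) w k * G (x k)) / \sum_(0 <= j < n.+1) w j.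
Proof.
move=> cG; elim: n => [|n IHn] w0.
  have w00 : w 0%N != 0 by rewrite gt_eqF ?w0.
  by rewrite !big_nat1 divff// scale1r mulrAC divff// mul1r.
have wn : 0 < w n.+1 by exact: w0.
have {}IHn := IHn (fun k kn => w0 k (leqW kn)).
rewrite !(big_nat_recr n.+1)//=.
set W := \sum_(0 <= j < n.+1) w j in IHn *.
have W0 : 0 < W.
  rewrite /W big_nat_recr//= ltr_wpDl ?w0// big_nat sumr_ge0// => k /andP[_ kn].
  by rewrite ltW ?w0// ltnW// ltnW.
have V0 : 0 < W + w n.+1 by rewrite addr_gt0.
pose s := W / (W + w n.+1).
have s01 : 0 <= s <= 1.
  apply/andP; split; first exact/ltW/divr_gt0.
  by rewrite ler_pdivrMr// mul1r lerDl ltW.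
have s'E : 1 - s = w n.+1 / (W + w n.+1) by rewrite /s; field; rewrite gt_eqF.
have -> : \sum_(0 <= k < n.+1) (w k / (W + w n.+1)) *: x k
    = s *: \sum_(0 <= k < n.+1) (w k / W) *: x k.
  rewrite scaler_sumr; apply: eq_bigr => k _; rewrite scalerA; congr (_ *: _).
  by rewrite /s; field; rewrite !gt_eqF.
rewrite -s'E; apply: le_trans (cG _ _ _ s01) _.
rewrite [leRHS]mulrDl [w n.+1 * _ / _]mulrAC -s'E lerD2r.
have -> : (\sum_(0 <= k < n.+1) w k * G (x k)) / (W + w n.+1)
    = s * ((\sum_(0 <= k < n.+1) w k * G (x k)) / W).
  by rewrite /s; field; rewrite !gt_eqF.
by rewrite ler_wpM2l//; case/andP: s01.
Qed.

(** The ratio of consecutive weights is at least 1 because [c <= 1]. This yields positivity and,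
    later, a total weight of at least [K * w 0]. *)
Lemma igd_weights_mono (alpha beta c : R) (K : nat) w :
  0 < alpha -> 0 < beta -> c <= 1 -> igd_weights alpha beta c K w ->
  forall k, (k < K)%N -> 0 < w 0%N <= w k.
Proof.
move=> al0 be0 c1 [w0 wS]; elim=> [|k IHk] kK; first by rewrite w0 lexx.
have /andP[_ wk] := IHk (ltnW kK); rewrite w0 (le_trans wk)//=.
rewrite (wS k.+1)/=; last by rewrite ltn_predRL.
have p0 : 0 < (1 + alpha / beta) * (K - k.+1)%:R.
  by rewrite mulr_gt0 ?addr_gt0 ?divr_gt0// ltr0n subn_gt0.
rewrite ler_peMl ?(le_trans (ltW w0))// ler_pdivlMr// mul1r -addrA lerDl.
by rewrite subr_ge0.
Qed.

(* The comparison points z_0 = xs and w_k z_k = (w_k - w_{k-1}) x_k +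
   w_{k-1} z_{k-1} make the distance terms telescope, and the recursion for w
   is chosen so that each x_k keeps exactly the weight c w_{k-1}. *)
Lemma weighted_telescope (alpha beta c : R) (K : nat) w x xs G (E B : R) :
  0 < alpha -> 0 < beta -> 0 < c <= 1 -> 0 <= B -> (0 < K)%N ->
  igd_weights alpha beta c K w ->
  segment_convex G -> G xs = 0 -> (forall u, 0 <= G u) ->
  (forall k z, G (x k.+1) <= (1 + alpha / beta) * G z + E
    + B * (dot (x k - z) (x k - z) - dot (x k.+1 - z) (x k.+1 - z))) ->
  c * \sum_(0 <= k < K) w k * G (x k.+1)
    <= E * \sum_(0 <= k < K) w k + B * (w 0%N * dot (x 0%N - xs) (x 0%N - xs)).
Proof.
move=> al0 be0 /andP[c0 c1] B0 K0 wP cG Gxs G0 step.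
have wm := igd_weights_mono _ _ _ _ _ al0 be0 c1 wP.
have wgt0 k : (k < K)%N -> 0 < w k.
  by move=> kK; have /andP[] := wm k kK; exact: lt_le_trans.
set r := 1 + alpha / beta in step.
have r0 : 0 < r by rewrite addr_gt0 ?divr_gt0.
pose D := dot (x 0%N - xs) (x 0%N - xs).
(* The term in [G z] is a reserve: each of the [K - n] remaining epochs will spend [r * w n * G z]
   of it. The range stops at [K - 1], where the recursion for [w] ends. *)
have inv n : (n < K)%N -> exists z,
    c * (\sum_(0 <= k < n) w k * G (x k.+1)) + r * (K - n)%:R * (w n * G z)
      + B * (w n * dot (x n - z) (x n - z))
    <= E * (\sum_(0 <= k < n) w k) + B * (w 0%N * D).
  elim: n => [_|n IHn nK].
    by exists xs; rewrite !big_geq// Gxs !mulr0 !add0r.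
  have [z zP] := IHn (ltnW nK).
  have wn := wgt0 n (ltnW nK); have wn1 := wgt0 _ nK.
  have m0 : 0 < r * (K - n.+1)%:R by rewrite mulr_gt0// ltr0n subn_gt0.
  have wE : r * (K - n.+1)%:R * w n.+1 = (r * (K - n.+1)%:R + 1 - c) * w n.
    rewrite (wP.2 n.+1)/=; last by rewrite ltn_predRL.
    by rewrite -/r; move: (r * _) m0 => m m0; field; rewrite gt_eqF.
  pose s := w n / w n.+1.
  have s0 : 0 < s by rewrite divr_gt0.
  have s1 : s <= 1.
    by rewrite ler_pdivrMr// mul1r -(ler_pM2l m0) wE ler_pM2r//; lra.
  pose z' := s *: z + (1 - s) *: x n.+1; exists z'.
  have Gz' : G z' <= s * G z + (1 - s) * G (x n.+1).
    by apply: cG; rewrite ltW.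
  have dz' : dot (x n.+1 - z') (x n.+1 - z')
      = s ^+ 2 * dot (x n.+1 - z) (x n.+1 - z).
    have -> : x n.+1 - z' = s *: (x n.+1 - z).
      by apply/rowP => i; rewrite !mxE; ring.
    by rewrite dotZl dotZr mulrA expr2.
  have KnE : (K - n)%:R = (K - n.+1)%:R + 1 :> R.
    by rewrite natr1 subnSK// ltnW.
  rewrite !(big_nat_recr n)//= dz'.
  have sw : w n.+1 * s = w n by rewrite mulrC divfK// gt_eqF.
  (* By [wE], moving from [z] to [z'] charges [G (x n.+1)] exactly [(1 - c) * w n]. Against the full
     [w n] on the left of [h3], this leaves [c * w n]. *)
  have h1 : r * (K - n.+1)%:R * (w n.+1 * G z')
      <= r * (K - n.+1)%:R * (w n * G z) + (1 - c) * (w n * G (x n.+1)).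
    apply: (@le_trans _ _ (r * (K - n.+1)%:R *
        (w n.+1 * (s * G z + (1 - s) * G (x n.+1))))).
      by rewrite ler_pM2l// ler_pM2l.
    rewrite [w n.+1 * (_ + _)]mulrDr [w n.+1 * (s * _)]mulrA sw.
    rewrite [w n.+1 * (_ * _)]mulrA [w n.+1 * (1 - s)]mulrBr mulr1 sw.
    rewrite [r * _ * (_ + _)]mulrDr lerD2l [leLHS]mulrA mulrBr wE.
    by rewrite [leLHS](_ : _ = (1 - c) * (w n * G (x n.+1))) //; ring.
  have h2 : B * (w n.+1 * (s ^+ 2 * dot (x n.+1 - z) (x n.+1 - z)))
      <= B * (w n * dot (x n.+1 - z) (x n.+1 - z)).
    rewrite ler_wpM2l// mulrA ler_wpM2r ?dot_ge0// expr2 mulrA sw.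
    by rewrite ler_piMr// ltW.
  have h3 : w n * G (x n.+1) <= w n * (r * G z + E
      + B * (dot (x n - z) (x n - z) - dot (x n.+1 - z) (x n.+1 - z))).
    by rewrite ler_pM2l.
  by rewrite KnE in zP; lra.
have KE : K.-1.+1 = K by rewrite prednK.
have KK : (K.-1 < K)%N by rewrite KE.
(* The last epoch is handled apart, since no weight of index [K] is available: the reserve is
   exactly [r * w K.-1 * G z], and [c <= 1] lowers the weight of the last iterate. *)
have [z] := inv _ KK; rewrite -{2 4 5}KE subSnn mulr1 /=.
have := ler_wpM2l (ltW (wgt0 _ KK)) (step K.-1 z).
rewrite -[in X in _ -> _ -> X]KE !(big_nat_recr K.-1)//= -/D.
have : c * (w K.-1 * G (x K.-1.+1)) <= w K.-1 * G (x K.-1.+1).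
  by rewrite ler_piMl// mulr_ge0 ?G0// ltW ?wgt0.
have : 0 <= B * (w K.-1 * dot (x K.-1.+1 - z) (x K.-1.+1 - z)).
  by rewrite mulr_ge0// mulr_ge0 ?dot_ge0// ltW ?wgt0.
by lra.
Qed.

End Averaging.

(** * The error bound for the averaged iterate *)

Section Convergence.
Context {R : realType} {d T : nat} {f : 'I_T -> 'rV[R]_d -> R}.
Implicit Types (x y z xs : 'rV[R]_d) (eta L alpha beta c : R).

Lemma average_segment_convex xs : (forall t, convex_fun (f t)) ->
  segment_convex (fun x => average f x - average f xs).
Proof.
move=> cf s u v s01.
have : average f (s *: u + (1 - s) *: v)
    <= s * average f u + (1 - s) * average f v.
  rewrite /average !mulrA -mulrDl ler_wpM2r ?invr_ge0//.
  rewrite !mulr_sumr -big_split; apply: ler_sum => t _.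
  exact: (convex_funE (cf t)).
by lra.
Qed.

Lemma average_progress L alpha beta eta xs x z :
  (0 < T)%N -> 0 < L -> 0 < alpha -> 0 < beta -> 0 < eta ->
  2^-1 + alpha^-1 + beta^-1 <= 1 ->
  beta * (eta * T%:R * L) ^+ 2 <= 1 ->
  (forall t, smooth L (f t)) -> (forall t, convex_fun (f t)) ->
  (forall x, average f xs <= average f x) ->
  average f (igd_epoch f eta x) - average f xs <=
    (1 + alpha / beta) * (average f z - average f xs)
    + T%:R ^+ 2 * sigma2 f xs * eta ^+ 2 * L
    + (2 * eta * T%:R)^-1 * (dot (x - z) (x - z)
        - dot (igd_epoch f eta x - z) (igd_epoch f eta x - z)).
Proof.
move=> T0 L0 al0 be0 e0 ab small sf cf min.
have TR0 : 0 < T%:R :> R by rewrite ltr0n.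
have gs0 := sum_grad_minimizer L xs T0 L0 sf min.
have := epoch_progress L alpha beta eta xs x z L0 al0 be0 e0 ab small sf cf gs0.
have avgE a b : \sum_t (f t a - f t b) = T%:R * (average f a - average f b).
  by rewrite sumrB /average; field; rewrite gt_eqF.
have -> : \sum_t dot (grad (f t) xs) (grad (f t) xs) = T%:R * sigma2 f xs.
  rewrite /sigma2 mulrC divfK ?gt_eqF//.
  by apply: eq_bigr => t _; rewrite enorm_sqr.
rewrite !avgE; set dd := dot (x - z) _ - dot _ _.
have -> : (2 * eta)^-1 * dd = T%:R * ((2 * eta * T%:R)^-1 * dd).
  by field; rewrite !gt_eqF.
set r := alpha / beta; set Q := _^-1 * dd => h.
by rewrite -(ler_pM2l TR0); lra.
Qed.

Lemma igd_average_bound L alpha beta c eta (K : nat) (w : nat -> R) x0 xs :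
  0 < alpha -> 0 < beta -> 1 / alpha + 1 / beta <= 1 / 2 ->
  (1 <= T)%N -> 0 < L ->
  (forall t, convex_fun (f t)) -> (forall t, smooth L (f t)) ->
  (forall x, average f xs <= average f x) -> 0 < c <= 1 -> (1 <= K)%N ->
  0 < eta <= 1 / (Num.sqrt beta * T%:R * L) ->
  igd_weights alpha beta c K w ->
  average f (weighted_avg w (igd f (fun=> eta) x0) K) - average f xs
    <= T%:R ^+ 2 * sigma2 f xs * eta ^+ 2 * L / c
       + enorm (x0 - xs) ^+ 2 / (2 * c * eta * T%:R * K%:R).
Proof.
move=> al0 be0 ab T0 L0 cf sf min c01 K0 /andP[e0 ele] wP.
have TR0 : 0 < T%:R :> R by rewrite ltr0n.
have KR0 : 0 < K%:R :> R by rewrite ltr0n.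
have sb0 : 0 < Num.sqrt beta by rewrite sqrtr_gt0.
have small : beta * (eta * T%:R * L) ^+ 2 <= 1.
  have -> : beta * (eta * T%:R * L) ^+ 2
      = (eta * (Num.sqrt beta * T%:R * L)) ^+ 2.
    by rewrite -{1}(sqr_sqrtr (ltW be0)); ring.
  rewrite expr_le1//; last by rewrite !mulr_ge0// ltW.
  by rewrite -ler_pdivlMr ?mulr_gt0.
have ab' : 2^-1 + alpha^-1 + beta^-1 <= 1 by lra.
pose x := igd f (fun=> eta) x0.
pose G u := average f u - average f xs.
pose E := T%:R ^+ 2 * sigma2 f xs * eta ^+ 2 * L.
pose B := (2 * eta * T%:R)^-1.
have G0 u : 0 <= G u by rewrite subr_ge0.
have cG : segment_convex G by exact: average_segment_convex.
have B0 : 0 <= B by rewrite invr_ge0 !mulr_ge0// ltW.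
have main := weighted_telescope alpha beta c K w x xs G E B al0 be0 c01 B0 K0 wP
  cG (subrr _) G0 (fun k z => average_progress L alpha beta eta xs (x k) z
    T0 L0 al0 be0 e0 ab' small sf cf min).
case/andP: c01 => c0 c1.
have wm := igd_weights_mono _ _ _ _ _ al0 be0 c1 wP.
have w0 : 0 < w 0%N := wP.1.
have KE : K.-1.+1 = K by rewrite prednK.
set W := \sum_(0 <= k < K) w k in main.
(* Turns the ratio [w 0 / W] in front of the initial distance into [1 / K]. *)
have KW : K%:R * w 0%N <= W.
  have -> : K%:R * w 0%N = \sum_(0 <= k < K) w 0%N.
    by rewrite sumr_const_nat subn0 mulr_natl.
  by apply: ler_sum_nat => k /andP[_ kK]; have /andP[] := wm k kK.
have W0 : 0 < W by apply: lt_le_trans KW; rewrite mulr_gt0.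
have -> : weighted_avg w x K = \sum_(0 <= k < K) (w k / W) *: x k.+1.
  by rewrite /weighted_avg !big_add1/=.
have wgt0 k : (k <= K.-1)%N -> 0 < w k.
  by rewrite -ltnS KE => kK; have /andP[] := wm k kK; exact: lt_le_trans.
have := jensen_nat G w (fun k => x k.+1) K.-1 cG wgt0; rewrite KE -/W -/(G _).
set S := \sum_(0 <= k < K) w k * _ in main *.
set v := \sum_(0 <= k < K) _ *: _ => GS.
apply: (le_trans GS); rewrite ler_pdivrMr// -(ler_pM2l c0).
apply: (le_trans main).
rewrite -enorm_sqr; set D := enorm _ ^+ 2.
have D0 : 0 <= D by rewrite sqr_ge0.
have -> : c * ((E / c + D / (2 * c * eta * T%:R * K%:R)) * W)
    = E * W + B * (W / K%:R * D).
  by rewrite /B; field; rewrite !gt_eqF.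
by rewrite lerD2l ler_wpM2l// ler_wpM2r// ler_pdivlMr// mulrC.
Qed.

End Convergence.

(** * Choice of step size and number of epochs *)

Lemma powR_half (R : realType) (a : R) : 0 <= a -> a `^ (1 / 2) = Num.sqrt a.
Proof. by move=> a0; rewrite mul1r powR12_sqrt. Qed.

Lemma powR_three_half (R : realType) (a : R) : 0 < a ->
  a `^ (3 / 2) = a * Num.sqrt a.
Proof.
move=> a0; have -> : 3 / 2 = 1 + 1 / 2 :> R by field.
by rewrite powRD ?gt_eqF ?implybT// powRr1 ?powR_half ?ltW.
Qed.

(* The step size is the harmonic combination of 1 / (b t L), which keeps the
   error bound valid, and sqrt (c eps / L) / (2 t s), which makes its noise
   term at most eps / 4. *)
Lemma step_size_exists (R : realType) (t L b s D c eps : R) :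
  0 < t -> 0 < L -> 0 < b -> 0 <= s -> 0 <= D -> 0 < c -> 0 < eps ->
  let X := t * L * D / (c * eps)
     + t * L `^ (1 / 2) * s * D / (c `^ (3 / 2) * eps `^ (3 / 2)) in
  t <= X ->
  exists (K : nat) (eta : R), [/\ (1 <= K)%N, 0 < eta <= 1 / (b * t * L),
    t * K%:R <= (b + 3) * X &
    t ^+ 2 * s ^+ 2 * eta ^+ 2 * L / c + D / (2 * c * eta * t * K%:R) <= eps].
Proof.
move=> t0 L0 b0 s0 D0 c0 eps0 X tX.
have [tge Lge cge ege] := And4 (ltW t0) (ltW L0) (ltW c0) (ltW eps0).
pose q := Num.sqrt c * Num.sqrt eps; pose l := Num.sqrt L.
have l0 : 0 < l by rewrite sqrtr_gt0.
have q0 : 0 < q by rewrite mulr_gt0 ?sqrtr_gt0.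
have [lge qge] := conj (ltW l0) (ltW q0).
have q2 : q ^+ 2 = c * eps by rewrite exprMn !sqr_sqrtr ?ltW.
have l2 : l ^+ 2 = L by rewrite sqr_sqrtr ?ltW.
pose X1 := t * L * D / (c * eps); pose X2 := t * l * s * D / (c * eps * q).
have XE : X = X1 + X2.
  rewrite /X powR_half ?ltW// !powR_three_half// /X1 /X2 /q -/l.
  by rewrite [c * _ * (eps * _)]mulrACA.
have X10 : 0 <= X1 by rewrite divr_ge0 ?mulr_ge0.
have X20 : 0 <= X2 by rewrite divr_ge0 ?mulr_ge0.
pose m := b * t * L; have m0 : 0 < m by rewrite !mulr_gt0.
(* Working with reciprocals of step sizes avoids dividing by [s], which may be zero. *)
pose p := 2 * t * s * l / q.
have p0 : 0 <= p by rewrite divr_ge0 ?mulr_ge0.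
have mp0 : 0 < m + p by rewrite ltr_pwDl.
have [eta etaE] : exists eta, eta = (m + p)^-1 by exists (m + p)^-1.
have eta0 : 0 < eta by rewrite etaE invr_gt0.
(* The real number of epochs at which the distance term would equal [eps / 2]; rounding up strictly
   keeps [K] positive. *)
pose k := D / (c * eta * t * eps).
have k0 : 0 <= k by rewrite divr_ge0 ?mulr_ge0// ltW.
have /andP[kle klt] := truncn_itv k0.
exists (Num.trunc k).+1, eta; split => //.
- by rewrite eta0 div1r etaE lef_pV2 ?posrE// lerDl.
(* Rounding adds at most one epoch, of cost [t <= X]. The total is at most [(b + 1) * X1 + 3 * X2],
   whence the constant [b + 3]. *)
- have tk : t * k = b * X1 + 2 * X2.
    have -> : t * k = D / (c * eps) * eta^-1.
      by rewrite /k; field; rewrite !gt_eqF.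
    by rewrite etaE invrK /X1 /X2 /p /m; field; rewrite !gt_eqF.
  rewrite -natr1 mulrDr mulr1.
  have : t * (Num.trunc k)%:R <= t * k by rewrite ler_pM2l.
  rewrite tk XE mulrDl; rewrite XE in tX.
  have : 0 <= b * X2 by rewrite mulr_ge0// ltW.
  by lra.
- set K := (Num.trunc k).+1%:R in klt *.
  have K0 : 0 < K by rewrite ltr0n.
  have ep : (eta * p) ^+ 2 <= 1.
    have : eta * p <= 1 by rewrite mulrC etaE ler_pdivrMr// mul1r lerDr ltW.
    by rewrite expr_le1// mulr_ge0// ltW.
  have -> : t ^+ 2 * s ^+ 2 * eta ^+ 2 * L / c = eps / 4 * (eta * p) ^+ 2.
    have -> : eps = q ^+ 2 / c by rewrite q2 mulrAC divff ?mul1r// gt_eqF.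
    rewrite -l2 /p.
    by field; rewrite !gt_eqF.
  have noise : eps / 4 * (eta * p) ^+ 2 <= eps / 4.
    by rewrite ler_piMr// divr_ge0 ?ltW.
  have dist : D / (2 * c * eta * t * K) <= eps / 2.
    have -> : D / (2 * c * eta * t * K) = k * (eps / 2 / K).
      by rewrite /k; field; rewrite !gt_eqF.
    by rewrite mulrA ler_pdivrMr// mulrC ler_pM2l ?divr_gt0// ltW.
  by apply: le_trans (lerD noise dist) _; lra.
Qed.

Theorem corollary2p4 (R : realType) (alpha beta : R)
    (alpha_gt0 : 0 < alpha) (beta_gt0 : 0 < beta)
    (alpha_beta : 1 / alpha + 1 / beta <= 1 / 2) :
  exists C : R, 0 < C /\
  forall (d T : nat) (L : R) (f : 'I_T -> 'rV[R]_d -> R)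
         (xs x0 : 'rV[R]_d) (c : R),
    (1 <= T)%N -> 0 < L ->
    (forall t, convex_fun (f t)) -> (forall t, smooth L (f t)) ->
    (forall x, average f xs <= average f x) ->
    0 < c <= 1 ->
    (forall (K : nat) (eta : R) (w : nat -> R),
        (1 <= K)%N ->
        0 < eta <= 1 / (Num.sqrt beta * T%:R * L) ->
        igd_weights alpha beta c K w ->
        average f (weighted_avg w (igd f (fun=> eta) x0) K) - average f xs
          <= T%:R ^+ 2 * sigma2 f xs * eta ^+ 2 * L / c
             + enorm (x0 - xs) ^+ 2 / (2 * c * eta * T%:R * K%:R))
    /\
    (forall eps : R, 0 < eps ->
      let X := T%:R * L * enorm (x0 - xs) ^+ 2 / (c * eps)
             + T%:R * L `^ (1 / 2) * sigma f xs * enorm (x0 - xs) ^+ 2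
               / (c `^ (3 / 2) * eps `^ (3 / 2)) in
      T%:R <= X ->
      exists (K : nat) (eta : R),
        [/\ (1 <= K)%N,
            0 < eta <= 1 / (Num.sqrt beta * T%:R * L),
            (T * K)%:R <= C * X &
            forall w : nat -> R, igd_weights alpha beta c K w ->
              average f (weighted_avg w (igd f (fun=> eta) x0) K)
                - average f xs <= eps]).
Proof.
have sb0 : 0 < Num.sqrt beta by rewrite sqrtr_gt0.
(* The constant [b + 3] of [step_size_exists] with [b] the square root of [beta]. *)
exists (Num.sqrt beta + 3); split; first exact: addr_gt0.
move=> d T L f xs x0 c T0 L0 cf sf min c01.
have bound K eta w := igd_average_bound L alpha beta c eta K w x0 xs
  alpha_gt0 beta_gt0 alpha_beta T0 L0 cf sf min c01.
split=> [//|eps eps0 X TX].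
have TR0 : 0 < T%:R :> R by rewrite ltr0n.
have c0 : 0 < c by case/andP: c01.
have s2 : sigma f xs ^+ 2 = sigma2 f xs.
  by rewrite sqr_sqrtr// divr_ge0// sumr_ge0// => t _; rewrite sqr_ge0.
have [K [eta [K0 eta_le TK err]]] := step_size_exists _ _ _ _ _ _ _ _
  TR0 L0 sb0 (sqrtr_ge0 (sigma2 f xs)) (sqr_ge0 (enorm (x0 - xs))) c0 eps0 TX.
exists K, eta; split=> //; first by rewrite natrM.
by move=> w wP; apply: le_trans (bound K eta w K0 eta_le wP) _; rewrite -s2.
Qed.
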